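(* Let $k\geq 3$ be an integer. For $n\geq1$ let $M_{k,n}=[\underbrace{k,\ldots,k}_{n}]$ and $m_{k,n}=[\underbrace{k,\ldots,k}_{n},1]$, and define the open interval $G_{k,n}=\left(M_{k,n}+m_{k,n},\,2M_{k,n+1}\right)$ if $n$ is odd and $G_{k,n}=\left(2M_{k,n+1},\,M_{k,n}+m_{k,n}\right)$ if $n$ is even. Then $$S(k)+S(k)\subseteq \left[0,\tfrac{2}{k}\right]\setminus \bigcup_{n=1}^{\infty} G_{k,n}.$$
   Context: $[a_1,\ldots,a_n]$ denotes the finite regular continued fraction $\cfrac{1}{a_1+\cfrac{1}{\ddots+\cfrac{1}{a_n}}}$. For $x\in[0,1]$, $a_n(x)$ is the $n$-th partial quotient of its regular continued fraction; rationals are written with last partial quotient at least $2$ (and $1=[1]$). For an integer $k\geq1$, $S(k)=\{x\in[0,1]: a_n(x)\geq k \text{ for all } n\}$, where a rational belongs to $S(k)$ if all its defined partial quotients are $\geq k$, and $0\in S(k)$. $S(k)+S(k)=\{c+b:c,b\in S(k)\}$. *)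

(* Defs.v *)
From mathcomp Require Import all_boot all_order all_algebra.
From mathcomp Require Import all_classical all_reals.

Set Implicit Arguments.
Unset Strict Implicit.
Unset Printing Implicit Defensive.
Import Order.TTheory GRing.Theory Num.Theory.
Local Open Scope classical_set_scope.
Local Open Scope ring_scope.

Definition cfrac (R : realType) (s : seq nat) : R :=
  foldr (fun (a : nat) (t : R) => (a%:R + t)^-1) 0 s.

Definition gauss_map (R : realType) (x : R) : R :=
  if x == 0 then 0 else x^-1 - (Num.truncn x^-1)%:R.

(* a_n(x) for x in [0, 1] and n >= 1; the value None means that a_n(x) is not
   defined. The Gauss map expands a rational in ]0, 1[ with last partial
   quotient at least 2, gives 1 = [1], and gives 0 the empty expansion. *)
Definition partial_quotient (R : realType) (n : nat) (x : R) : option nat :=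
  let y := iter n.-1 (@gauss_map R) x in
  if y == 0 then None else Some (Num.truncn y^-1).

Definition cf_set (R : realType) (k : nat) : set R :=
  [set x | 0 <= x <= 1 /\
     forall n a : nat,
       (1 <= n)%N -> partial_quotient n x = Some a -> (k <= a)%N].

Definition cf_M (R : realType) (k n : nat) : R := cfrac R (nseq n k).

Definition cf_m (R : realType) (k n : nat) : R :=
  cfrac R (rcons (nseq n k) 1%N).

Definition gap (R : realType) (k n : nat) : set R :=
  if odd n then `]cf_M R k n + cf_m R k n, 2 * cf_M R k n.+1[%classic
  else `]2 * cf_M R k n.+1, cf_M R k n + cf_m R k n[%classic.

Arguments cf_set : clear implicits.
Arguments gap : clear implicits.

(* Main.v *)
Require Import Defs.
From mathcomp Require Import all_boot all_order all_algebra.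
From mathcomp Require Import all_classical all_reals.
From mathcomp Require Import ring lra.

Import Order.TTheory GRing.Theory Num.Theory.
Local Open Scope classical_set_scope.
Local Open Scope ring_scope.

(** Let [f t = 1 / (k + t)], so that [M_n = f^n 0] and [m_n = f^n 1]. The iterate
    [f^n] is a Moebius map, increasing or decreasing on [t >= 0] according to the
    parity of [n]. Given [x, y] in [S(k)], strip common leading partial quotients
    [k]. If [n] of them can be stripped, then [x + y] lies on the side of
    [2 M_{n+1} = 2 f^n (1/k)] prescribed by monotonicity. Otherwise, for some
    [j < n], [x + y = f^j s + f^j t] with [s <= 1/(k+1) = f 1] and
    [t <= 1/k = f 0], which bounds [x + y] by [m_{j+1} + M_{j+1}]. This is the
    wanted endpoint when [j = n - 1]; when [j < n - 1] one compares with
    [2 M_{j+2}], and this is where [k >= 3] is needed. *)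

Section CfStep.
Context {R : realType} (k : nat).
Hypothesis k_gt0 : (0 < k)%N.

Definition cf_step (t : R) : R := (k%:R + t)^-1.

Lemma cf_M_iter n : cf_M R k n = iter n cf_step 0.
Proof. by rewrite /cf_M /cfrac; elim: n => //= n ->. Qed.

Lemma cf_m_iter n : cf_m R k n = iter n cf_step 1.
Proof.
rewrite /cf_m /cfrac; elim: n => [|n /= ->] //=.
by rewrite addr0 invr1.
Qed.

Let kR_gt0 : 0 < k%:R :> R. Proof. by rewrite ltr0n. Qed.

Lemma cf_step_ge0 t : 0 <= t -> 0 <= cf_step t.
Proof. by move=> t0; rewrite invr_ge0 addr_ge0. Qed.

Lemma iter_cf_step_ge0 n t : 0 <= t -> 0 <= iter n cf_step t.
Proof. by move=> t0; elim: n => //= n; exact: cf_step_ge0. Qed.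

(** Writing [f^n t = (p + p' t) / (q + q' t)], of determinant 1 or -1, one has [D = q^2] and
    [e = q' / q], a ratio of consecutive convergent denominators. *)
Lemma iter_cf_step_sub n : exists D e : R, [/\ 0 < D, 0 <= e <= 1 &
  forall s t, 0 <= s -> 0 <= t ->
    iter n cf_step s - iter n cf_step t
    = (-1) ^+ n * (s - t) / (D * (1 + e * s) * (1 + e * t))].
Proof.
have k1 : 1 <= k%:R :> R by rewrite ler1n.
elim: n => [|n [D [e [D0 /andP[e0 e1] IH]]]].
  exists 1, 0; split; rewrite ?lexx ?ler01 // => s t _ _ /=.
  by rewrite !mul0r addr0 !mulr1 invr1 mulr1 expr0 mul1r.
have ke0 : 0 < k%:R + e by lra.
(* These come from [1 + e * f s = (k + e) * (1 + s / (k + e)) / (k + s)]. *)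
exists (D * (k%:R + e) ^+ 2), (k%:R + e)^-1; split.
- by rewrite mulr_gt0 // exprn_gt0.
- by rewrite invr_ge0 (ltW ke0) invf_le1 //; lra.
move=> s t s0 t0; rewrite !iterSr IH ?cf_step_ge0 // /cf_step exprS.
by field; rewrite !lt0r_neq0 //; lra.
Qed.

Lemma iter_cf_step_mono n s t : 0 <= s -> s <= t ->
  (-1) ^+ n * iter n cf_step s <= (-1) ^+ n * iter n cf_step t.
Proof.
move=> s0 st; have t0 := le_trans s0 st.
have [D [e [D0 /andP[e0 _] fE]]] := iter_cf_step_sub n.
rewrite -subr_ge0 -mulrBr fE // !mulrA -expr2 sqrr_sign mul1r.
by rewrite divr_ge0 ?subr_ge0 // !mulr_ge0 ?addr_ge0 ?mulr_ge0 // ltW.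
Qed.

Lemma iter_cf_step_nested j n w : (j <= n)%N -> 0 <= w ->
  (-1) ^+ j * iter j cf_step 0 <= (-1) ^+ j * iter n cf_step w.
Proof.
move=> /subnKC <- w0; rewrite iterD.
by apply: iter_cf_step_mono; rewrite ?iter_cf_step_ge0.
Qed.

(** Compare the increments of [f^n] over [[1/k, 1]] and [[0, 1/k]]: up to the sign and a positive
    denominator, their difference is [k - 2 - e], nonnegative because [e <= 1]. *)
Lemma cf_M_add_cf_m n : (3 <= k)%N ->
  (-1) ^+ n * (2 * cf_M R k n.+1) <= (-1) ^+ n * (cf_M R k n + cf_m R k n).
Proof.
move=> k3; have k3R : 3 <= k%:R :> R by rewrite (ler_nat _ 3).
rewrite !cf_M_iter cf_m_iter iterSr.
have [D [e [D0 /andP[e0 e1] fE]]] := iter_cf_step_sub n.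
have h0 : 0 <= cf_step 0 by exact: cf_step_ge0.
have sq : (-1) ^+ n * (-1) ^+ n = 1 :> R by rewrite -expr2 sqrr_sign.
have A := fE _ _ h0 (lexx 0); have B := fE _ _ ler01 h0.
rewrite -subr_ge0 -mulrBr.
set F := iter n cf_step in A B *.
have -> : F 0 + F 1 - 2 * F (cf_step 0)
          = (F 1 - F (cf_step 0)) - (F (cf_step 0) - F 0) by ring.
rewrite {}A {}B -!(mulrA ((-1) ^+ n)) -mulrBr mulrA sq mul1r.
have -> : cf_step 0 = k%:R^-1 by rewrite /cf_step addr0.
have -> : (1 - k%:R^-1) / (D * (1 + e * 1) * (1 + e * k%:R^-1)) -
          (k%:R^-1 - 0) / (D * (1 + e * k%:R^-1) * (1 + e * 0))
        = (k%:R - 2 - e) / (D * (1 + e) * (k%:R + e)).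
  by field; rewrite !lt0r_neq0 //; lra.
by rewrite divr_ge0 ?mulr_ge0 //; lra.
Qed.

Lemma in_gap n z : gap R k n z ->
  (-1) ^+ n * (2 * cf_M R k n.+1) < (-1) ^+ n * z
    < (-1) ^+ n * (cf_M R k n + cf_m R k n).
Proof.
rewrite /gap -signr_odd; case: (odd n); rewrite /= in_itv /= => /andP[h1 h2].
  by rewrite expr1 !mulN1r !ltrN2 h1 h2.
by rewrite expr0 !mul1r h1 h2.
Qed.

Lemma cf_set_le x : cf_set R k x -> 0 <= x <= k%:R^-1.
Proof.
move=> [/andP[x0 x1] xk]; rewrite x0 /=.
have [->|xn0] := eqVneq x 0; first by rewrite invr_ge0 ltW.
have xgt0 : 0 < x by rewrite lt0r xn0.
have := xk 1%N (Num.truncn x^-1) isT.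
rewrite /partial_quotient /= (negbTE xn0) => /(_ erefl) ka.
rewrite -(invrK x) lef_pV2 ?posrE ?invr_gt0 //.
apply: le_trans (_ : (Num.truncn x^-1)%:R <= _); first by rewrite ler_nat.
by rewrite truncn_le ?invr_ge0.
Qed.

Lemma cf_set_gauss_map x : cf_set R k x -> cf_set R k (gauss_map x).
Proof.
move=> [/andP[x0 x1] xk]; split.
  rewrite /gauss_map; case: eqVneq => [_|xn0]; first by rewrite lexx ler01.
  have /truncn_itv/andP[h1 h2] : 0 <= x^-1 by rewrite invr_ge0.
  by rewrite subr_ge0 h1 lerBlDr addrC -natr1 in h2 *; lra.
move=> [//|n] a _ h; apply: (xk n.+2 a) => //.
by rewrite /partial_quotient /= -iterS iterSr.
Qed.

(** Either the first partial quotient is [k] and the Gauss map supplies [t], or it is at least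
    [k + 1] and [x <= 1 / (k + 1)]. The point 0, which has no partial quotient, falls in the first
    alternative. *)
Lemma cf_setP x : cf_set R k x ->
  0 <= x <= cf_step 1 \/ exists2 t, cf_set R k t & x = cf_step t.
Proof.
move=> xS; have [/andP[x0 x1] xk] := xS.
have [->|xn0] := eqVneq x 0; first by left; rewrite lexx cf_step_ge0.
have := xk 1%N (Num.truncn x^-1) isT.
rewrite /partial_quotient /= (negbTE xn0) => /(_ erefl).
rewrite leq_eqVlt => /orP[/eqP ka|ka].
  right; exists (gauss_map x); first exact: cf_set_gauss_map.
  by rewrite /cf_step /gauss_map (negbTE xn0) -ka addrC subrK invrK.
left; rewrite x0 /= -(invrK x) lef_pV2 ?posrE ?invr_gt0 ?lt0r ?xn0 //; last first.
  by rewrite gt_eqF ?addr_ge0 ?addr_gt0.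
apply: le_trans (_ : (Num.truncn x^-1)%:R <= _); first by rewrite natr1 ler_nat.
by rewrite truncn_le ?invr_ge0.
Qed.

Lemma cf_set_add_strip n x y : cf_set R k x -> cf_set R k y ->
  (exists s t, [/\ cf_set R k s, cf_set R k t &
     x + y = iter n cf_step s + iter n cf_step t]) \/
  (exists j s t, [/\ (j < n)%N, 0 <= s <= cf_step 1, 0 <= t <= cf_step 0 &
     x + y = iter j cf_step s + iter j cf_step t]).
Proof.
move=> xS yS; elim: n => [|n [[s [t [sS tS xyE]]]|]]; first by left; exists x, y.
- have le0 u : cf_set R k u -> 0 <= u <= cf_step 0.
    by rewrite /cf_step addr0; exact: cf_set_le.
  have [s1|[s' s'S sE]] := cf_setP _ sS.
    by right; exists n, s, t; split; rewrite ?ltnSn ?le0.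
  have [t1|[t' t'S tE]] := cf_setP _ tS.
    by right; exists n, t, s; split; rewrite ?ltnSn ?le0 // xyE addrC.
  by left; exists s', t'; split; rewrite // !iterSr -sE -tE.
- move=> [j [s [t [jn hs ht xyE]]]]; right.
  by exists j, s, t; split; rewrite ?(ltn_trans jn).
Qed.

End CfStep.

Theorem theorem2 (R : realType) (k : nat) (hk : (3 <= k)%N) :
  [set c + b | c in cf_set R k & b in cf_set R k]
    `<=` `[0, 2 / k%:R]%classic `\`
         \bigcup_(n in [set n : nat | (1 <= n)%N]) gap R k n.
Proof.
have k0 : (0 < k)%N by exact: leq_trans hk.
move=> _ [x xS [y yS <-]]; split.
  have /andP[x0 x1] := cf_set_le k k0 x xS.
  have /andP[y0 y1] := cf_set_le k k0 y yS.
  by rewrite /= in_itv /=; lra.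
move=> [n _ /in_gap/andP[]].
have [[s [t [sS tS ->]]]|[j [s [t [jn /andP[s0 s1] /andP[t0 t1] ->]]]]] :=
  cf_set_add_strip k k0 n x y xS yS.
(* Both [s] and [t] are at most [1/k = f 0], so the signed sum is at most the signed [2 M_{n+1}]. *)
- have /andP[s0 s1] := cf_set_le k k0 s sS.
  have /andP[t0 t1] := cf_set_le k k0 t tS.
  have := iter_cf_step_mono k k0 n s _ s0 s1.
  have := iter_cf_step_mono k k0 n t _ t0 t1.
  by rewrite cf_M_iter iterSr /cf_step addr0 -/(cf_step k); lra.
have := lerD (iter_cf_step_mono k k0 j s _ s0 s1)
             (iter_cf_step_mono k k0 j t _ t0 t1).
rewrite -!iterSr -cf_M_iter -cf_m_iter -!mulrDr.
(* If [n = j + 1], the signs [(-1)^j] and [(-1)^n] are opposite, so the bound contradicts the other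
   end of the gap. *)
move: jn; rewrite leq_eqVlt => /orP[/eqP <-|jn].
  by rewrite exprS !mulN1r; lra.
(* If [j + 2 <= n], then [2 M_{j+2}] separates: [x + y] lies weakly on one side, and both ends of
   the gap lie weakly on the other, since [M_n], [m_n] and [M_{n+1}] are values of [f^(j+2)] at
   nonnegative points. *)
have := cf_M_add_cf_m k k0 j.+1 hk (R := R).
have := iter_cf_step_nested k k0 j.+2 n 0 jn (lexx (0 : R)).
have := iter_cf_step_nested k k0 j.+2 n 1 jn (@ler01 R).
have := iter_cf_step_nested k k0 j.+2 n.+1 0 (leqW jn) (lexx (0 : R)).
rewrite -!cf_M_iter -cf_m_iter !exprS !mulN1r opprK.
rewrite -(signr_odd _ j) -(signr_odd _ n).
by case: (odd j); case: (odd n); rewrite ?expr0 ?expr1; lra.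
Qed.
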